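(* Let $\alpha\in\mathbb{C}_2\setminus\{0\}$ and let $\lambda\in T(\alpha)$. Then either $\lambda\in\{-\alpha^3,\frac{\alpha^3}{8}\}$ or $$|\lambda|\in\{4|\alpha|^3,\ 4^{1-(1/4)^m}|\alpha|^3,\ 2^{2+(1/4)^m}|\alpha|^3 : m\in\mathbb{N},\ m\ge 1\}.$$ Moreover, exactly one of the following is true: (1) $|\lambda|=4|\alpha|^3$, and this holds if and only if $0,\infty\notin\mathcal{O}_{f_\lambda}(\alpha)$; (2) $|\lambda|=4^{1-(1/4)^m}|\alpha|^3$ for some integer $m\ge1$ or $\lambda=-\alpha^3$, and this holds if and only if $\infty\in\mathcal{O}_{f_\lambda}(\alpha)$; (3) $|\lambda|=2^{2+(1/4)^m}|\alpha|^3$ for some integer $m\ge1$ or $\lambda=\frac{\alpha^3}{8}$, and this holds if and only if $0\in\mathcal{O}_{f_\lambda}(\alpha)$.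
   Context: $\mathbb{C}_2$ is the completion of $\overline{\mathbb{Q}_2}$, with $2$-adic absolute value $|\cdot|$ normalized so that $|2|=\frac12$. For $\lambda\in\mathbb{C}_2\setminus\{0\}$, $f_\lambda(z)=\frac{z^4-8\lambda z}{4(z^3+\lambda)}$ acting on $\mathbb{P}^1(\mathbb{C}_2)$ (the Lattès map of the doubling map on $E_\lambda:y^2=x^3+\lambda$). For $\alpha\in\mathbb{C}_2\setminus\{0\}$, $T(\alpha)=\{\lambda\in\mathbb{C}_2\setminus\{0\}: \alpha \text{ is preperiodic for } f_\lambda\}$ and $\mathcal{O}_{f_\lambda}(\alpha)=\{f_\lambda^n(\alpha): n\in\mathbb{N}\}$, where $\mathbb{N}$ includes $0$ and $f^n$ is the $n$-th iterate. *)

(* Defs.v *)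
From HB Require Import structures.
From mathcomp Require Import all_boot all_order all_algebra.
From mathcomp Require Import all_classical all_reals all_analysis.

Set Implicit Arguments.
Unset Strict Implicit.
Unset Printing Implicit Defensive.

Import Order.TTheory GRing.Theory Num.Theory.

Local Open Scope classical_set_scope.
Local Open Scope ring_scope.

(** p-adic absolute value on the rationals, with |p| = 1/p *)

Definition padic_abs (R : realType) (p : nat) (x : rat) : R :=
  if x == 0 then 0
  else p%:R ^+ logn p `|denq x|%N / p%:R ^+ logn p `|numq x|%N.

Lemma padic_abs2 (R : realType) : padic_abs R 2 2 = 2^-1.
Proof.
rewrite /padic_abs -[2 : rat]/(2%:~R) numq_int denq_int /=.
by rewrite expr0 div1r.
Qed.

(** Valued fields and their completions *)

Record nonarch_absval (R : realType) (K : fieldType) (v : K -> R) : Prop := {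
  absval_ge0 : forall x, 0 <= v x;
  absval_eq0 : forall x, v x = 0 <-> x = 0;
  absvalM : forall x y, v (x * y) = v x * v y;
  absval_ultra : forall x y, v (x + y) <= Num.max (v x) (v y) }.

Definition absval_cauchy (R : realType) (K : fieldType) (v : K -> R)
    (u : nat -> K) : Prop :=
  forall e : R, 0 < e ->
    exists N : nat, forall m n : nat, (N <= m)%N -> (N <= n)%N ->
      v (u m - u n) < e.

Definition absval_cvg (R : realType) (K : fieldType) (v : K -> R)
    (u : nat -> K) (l : K) : Prop :=
  forall e : R, 0 < e ->
    exists N : nat, forall n : nat, (N <= n)%N -> v (u n - l) < e.

Record is_completion (R : realType) (K L : fieldType) (v : K -> R) (w : L -> R)
    (i : {rmorphism K -> L}) : Prop := {
  completion_absval : nonarch_absval w;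
  completion_isometry : forall x, w (i x) = v x;
  completion_dense : forall (y : L) (e : R), 0 < e -> exists x, w (y - i x) < e;
  completion_complete : forall u : nat -> L,
    absval_cauchy w u -> exists l, absval_cvg w u l }.

(** [is_C2 K v]: the valued field [(K, v)] is a model of the field C_2, which is
    determined by this up to isometric isomorphism.  The tower is
    Q -> Q_2 -> Qbar_2 -> K: completion, algebraic closure, completion. *)

Definition is_C2 (R : realType) (K : fieldType) (v : K -> R) : Prop :=
  exists (Q2 : fieldType) (v2 : Q2 -> R) (i : {rmorphism rat -> Q2})
         (Q2bar : closedFieldType) (v2bar : Q2bar -> R)
         (j : {rmorphism Q2 -> Q2bar}) (k : {rmorphism Q2bar -> K}),
    [/\ is_completion (padic_abs R 2) v2 i,
        forall x : Q2bar, algebraicOver j x,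
        nonarch_absval v2bar /\ (forall x, v2bar (j x) = v2 x)
      & is_completion v2bar v k].

(** Dynamics on the projective line; P^1(K) is [option K], the point at infinity
    being [None] *)

(** For [lam != 0] and 3 != 0 in K, the numerator and the denominator have no
    common zero, so the poles are exactly the zeros of the denominator; infinity
    is fixed because the numerator has the larger degree. *)
Definition lattes (K : fieldType) (lam : K) (x : option K) : option K :=
  if x is Some z then
    if 4 * (z ^+ 3 + lam) == 0 then None
    else Some ((z ^+ 4 - 8 * lam * z) / (4 * (z ^+ 3 + lam)))
  else None.

Definition forward_orbit (T : Type) (f : T -> T) (x : T) : set T :=
  [set iter n f x | n in [set: nat]].

Definition preperiodic (T : Type) (f : T -> T) (x : T) : Prop :=
  exists m n : nat, (m < n)%N /\ iter m f x = iter n f x.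

Definition preperiodic_params (K : fieldType) (alpha : K) : set K :=
  [set lam | lam != 0 /\ preperiodic (lattes lam) (Some alpha)].

Definition exactly_one3 (P Q S : Prop) : Prop :=
  [\/ [/\ P, ~ Q & ~ S], [/\ ~ P, Q & ~ S] | [/\ ~ P, ~ Q & S]].

(* Main.v *)
(** The coordinate t = z^3 / lam semiconjugates f_lam to a map g independent of
    lam, with |g(t)| = 64 |t| |t - 8|^3 / |t + 1|^3.  In terms of the normalized
    size s = 4 |t|, the map is s |-> s^4 on the annulus 1/2 < s < 4, so the
    circle s = 1 is invariant.  Beyond s = 4 sizes grow by the factor 64 and
    below s = 1/2 they shrink by the factor 8.  Hence a preperiodic orbit off the
    circle hits s = 4 or s = 1/2 exactly, and there it must pass through t = -1
    (then infinity) or t = 8 (then 0).  Solving s^(4^m) = 4 or 1/2 gives the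
    listed values of |lam|. *)

Require Import Defs.
From HB Require Import structures.
From mathcomp Require Import all_boot all_order all_algebra.
From mathcomp Require Import all_classical all_reals all_analysis.
From mathcomp Require Import ring lra.

Set Implicit Arguments.
Unset Strict Implicit.
Unset Printing Implicit Defensive.

Import Order.TTheory GRing.Theory Num.Theory.

Local Open Scope classical_set_scope.
Local Open Scope ring_scope.

(** * Consequences of the ultrametric inequality *)

Section Absval.
Context (R : realType) (K : fieldType) (v : K -> R) (vP : nonarch_absval v).

Lemma absval0 : v 0 = 0.
Proof. exact/(absval_eq0 vP). Qed.

Lemma absval_gt0 x : (0 < v x) = (x != 0).
Proof.
rewrite lt0r (absval_ge0 vP) andbT; congr (~~ _).
by apply/eqP/eqP => /(absval_eq0 vP).
Qed.

Lemma absval1 : v 1 = 1.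
Proof.
have v1 : v 1 != 0 by rewrite gt_eqF // absval_gt0 oner_neq0.
by apply: (mulfI v1); rewrite -(absvalM vP) !mulr1.
Qed.

Lemma absvalN x : v (- x) = v x.
Proof.
suff vN1 : v (- 1) = 1 by rewrite -mulN1r (absvalM vP) vN1 mul1r.
apply/eqP; rewrite -sqrp_eq1 ?(absval_ge0 vP)//.
by rewrite expr2 -(absvalM vP) mulrNN mulr1 absval1.
Qed.

Lemma absvalX x n : v (x ^+ n) = v x ^+ n.
Proof.
by elim: n => [|n IH]; rewrite ?expr0 ?absval1// !exprS (absvalM vP) IH.
Qed.

Lemma absvalV x : v x^-1 = (v x)^-1.
Proof.
have [->|x0] := eqVneq x 0; first by rewrite invr0 absval0 invr0.
have vx0 : v x != 0 by rewrite gt_eqF // absval_gt0.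
by apply: (mulfI vx0); rewrite -(absvalM vP) !mulfV // absval1.
Qed.

(** Writing [y = (x + y) - x], the ultrametric inequality forces [v y <= v (x + y)], since
    [v y <= v x] is excluded. *)
Lemma absval_addr x y : v x < v y -> v (x + y) = v y.
Proof.
move=> xy; apply/le_anti/andP; split.
  by have := absval_ultra vP x y; rewrite (max_r (ltW xy)).
have := absval_ultra vP (x + y) (- x).
rewrite addrAC subrr add0r absvalN le_max => /orP[//|].
by rewrite leNgt xy.
Qed.

Lemma absval_addl x y : v y < v x -> v (x + y) = v x.
Proof. by rewrite addrC; exact: absval_addr. Qed.

End Absval.

(** Every map of the tower is an isometry, so [2] keeps the absolute value it has in [rat]. *)
Lemma is_C2_absval {R : realType} {K : fieldType} {v : K -> R} :
  is_C2 v -> nonarch_absval v /\ v 2 = 2^-1.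
Proof.
move=> [Q2 [v2 [i [Qb [vb [j [k [Ci _ [_ vbj] Ck]]]]]]]].
split; first exact: completion_absval Ck.
have -> : 2 = k (j (i 2)) by rewrite !rmorph_nat.
by rewrite (completion_isometry Ck) vbj (completion_isometry Ci) padic_abs2.
Qed.

(** * Preperiodic points and real powers with exponent [4 ^ n] *)

Lemma preperiodic_iter {T : Type} {f : T -> T} {x : T} n :
  preperiodic f x -> preperiodic f (iter n f x).
Proof.
move=> [i [j [ij e]]]; exists i, j; split => //.
by rewrite -!iterD ![(_ + n)%N]addnC !iterD e.
Qed.

(** This root extraction produces the exponents [(1/4)^m] of the theorem. *)
Lemma expX4_powR {R : realType} (x c : R) m : 0 < x ->
  x ^+ (4 ^ m) = c -> x = c `^ ((1 / 4) ^+ m).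
Proof.
move=> x0 <-; rewrite -powR_mulrn ?ltW// -powRrM natrX -exprMn.
by rewrite mul1r mulfV ?expr1n ?powRr1 ?ltW ?pnatr_eq0.
Qed.

Lemma bernoulli_ineq {R : realType} (x : R) n : 0 <= x ->
  1 + n%:R * x <= (1 + x) ^+ n.
Proof.
move=> x0; elim: n => [|n IH]; first by rewrite mul0r addr0 expr0.
have x10 : 0 <= 1 + x by lra.
rewrite exprS; apply: le_trans (ler_wpM2l x10 IH).
have : 0 <= n%:R :> R by [].
rewrite -natr1; move: (n%:R) => k k0.
have := mulr_ge0 k0 (mulr_ge0 x0 x0); lra.
Qed.

(** Bernoulli gives [x^n >= 1 + n (x - 1)], and [n < 4^n]. *)
Lemma expX4_unbounded {R : realType} (x c : R) : 1 < x ->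
  exists n, c <= x ^+ (4 ^ n).
Proof.
move=> x1; pose n := Num.bound `|c / (x - 1)|; exists n.
have x10 : 0 < x - 1 by lra.
have cn : c <= n%:R * (x - 1).
  rewrite -ler_pdivrMr//; apply/ltW/(le_lt_trans (ler_norm _)).
  exact/archi_boundP/normr_ge0.
have := bernoulli_ineq n (ltW x10).
rewrite [1 + (x - 1)]addrC subrK => b; apply: (@le_trans _ _ (x ^+ n)); first
  lra.
by apply: ler_weXn2l; [exact: ltW|exact/ltnW/ltn_expl].
Qed.

Lemma expX4_vanishing {R : realType} (x c : R) : 0 < x < 1 -> 0 < c ->
  exists n, x ^+ (4 ^ n) <= c.
Proof.
move=> /andP[x0 x1] c0.
have [|n] := @expX4_unbounded _ x^-1 c^-1; first by rewrite invf_gt1.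
by rewrite exprVn lef_pV2 ?posrE ?exprn_gt0//; exists n.
Qed.

(** * Effect of one step of the Lattès map on the normalized size *)

Section Lattes.
Context (R : realType) (K : fieldType) (v : K -> R) (vP : nonarch_absval v).
Context (v2 : v 2 = 2^-1).
Context (lam : K) (lam0 : lam != 0).

Let f := lattes lam.
Let L0 : 0 < v lam. Proof. by rewrite absval_gt0. Qed.

Definition nsize (z : K) : R := 4 * v z ^+ 3 / v lam.

Let v4 : v 4 = 4^-1.
Proof. by rewrite -[4%N]/((2 * 2)%N) natrM (absvalM vP) v2; lra. Qed.

Let v8lam : v (8 * lam) = v lam / 8.
Proof.
by rewrite -[8%N]/((4 * 2)%N) natrM !(absvalM vP) v2 v4; lra.
Qed.

Let nz4 : 4 != 0 :> K.
Proof. by rewrite -(absval_gt0 vP) v4; lra. Qed.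

Let vcube z : v (z ^+ 3) = nsize z * v lam / 4.
Proof.
rewrite (absvalX vP) /nsize; have := lt0r_neq0 L0; move: (v lam) => l l0.
by field.
Qed.

Lemma nsize_gt0 z : (0 < nsize z) = (z != 0).
Proof.
rewrite pmulr_lgt0 ?invr_gt0// pmulr_rgt0//.
by rewrite -(absvalX vP) (absval_gt0 vP) expf_eq0.
Qed.

Lemma lattes_pole z : z ^+ 3 = - lam -> f (Some z) = None.
Proof. by move=> e; rewrite /f/= e addNr mulr0 eqxx. Qed.

Lemma lattes_zero z : z ^+ 3 = 8 * lam -> f (Some z) = Some 0.
Proof.
move=> e; rewrite /f/= e; have -> : 8 * lam + lam = 9 * lam by ring.
(* The denominator is [36 lam]; it is nonzero because [9 = 8 + 1] with [|8| < 1], so [|9| = 1]. *)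
have n9 : 9 != 0 :> K.
  rewrite -(absval_gt0 vP) -[9%N]/((8 + 1)%N) natrD absval_addr ?absval1//.
  by rewrite -[8%N]/((4 * 2)%N) natrM (absvalM vP) v4 v2; lra.
rewrite !mulf_eq0 (negbTE nz4) (negbTE n9) (negbTE lam0)/=.
have -> : z ^+ 4 - 8 * lam * z = 0.
  by rewrite exprS e; ring.
by rewrite mul0r.
Qed.

Lemma iter_lattes_None n : iter n f None = None.
Proof. by elim: n => //= n ->. Qed.

Lemma iter_lattes_0 n : iter n f (Some 0) = Some 0.
Proof.
elim: n => //= n ->; rewrite /f/= expr0n add0r mulf_eq0
  (negbTE nz4) (negbTE lam0).
by rewrite expr0n mulr0 subrr mul0r.
Qed.

(** The constant 64 is [|1/4|^3], from the factor 4 in the denominator. *)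
Lemma lattes_nsize z : z ^+ 3 + lam != 0 -> exists2 w, f (Some z) = Some w &
  nsize w = 64 * nsize z * (v (z ^+ 3 - 8 * lam) / v (z ^+ 3 + lam)) ^+ 3.
Proof.
move=> nz; rewrite /f/= mulf_eq0 (negbTE nz4) (negbTE nz).
eexists; first by [].
have -> : z ^+ 4 - 8 * lam * z = z * (z ^+ 3 - 8 * lam) by ring.
rewrite /nsize !(absvalM vP) (absvalV vP) !(absvalM vP) v4.
have : v (z ^+ 3 + lam) != 0 by rewrite gt_eqF ?absval_gt0.
have := lt0r_neq0 L0; move: (v lam) (v (_ + lam)) (v (_ - _)) => a b c a0 b0.
by field; rewrite a0 b0.
Qed.

Lemma lattes_annulus z : 1 / 2 < nsize z < 4 ->
  exists2 w, f (Some z) = Some w & nsize w = nsize z ^+ 4.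
Proof.
(* The bounds say [|8 lam| < |z^3| < |lam|], so [lam] dominates the denominator and [z^3] the
   numerator. *)
rewrite -(ltr_pM2r L0) -[X in _ && X](ltr_pM2r L0) => /andP[s1 s2].
have vd : v (z ^+ 3 + lam) = v lam
  by apply: absval_addr => //; rewrite vcube; have := L0; lra.
have vn : v (z ^+ 3 - 8 * lam) = v (z ^+ 3).
  by apply: absval_addl => //; rewrite absvalN// v8lam vcube; have := L0; lra.
have [|w fw sw] := @lattes_nsize z; first by rewrite -(absval_gt0 vP) vd.
exists w => //; rewrite sw vn vd vcube.
by have := lt0r_neq0 L0; move: (v lam) => a a0; field.
Qed.

Lemma lattes_gt4 z : 4 < nsize z ->
  exists2 w, f (Some z) = Some w & nsize w = 64 * nsize z.
Proof.
rewrite -(ltr_pM2r L0) => s4.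
have vd : v (z ^+ 3 + lam) = v (z ^+ 3)
  by apply: absval_addl => //; rewrite vcube; have := L0; lra.
have vn : v (z ^+ 3 - 8 * lam) = v (z ^+ 3).
  by apply: absval_addl => //; rewrite absvalN// v8lam vcube; have := L0; lra.
have vz : 0 < v (z ^+ 3) by rewrite vcube; have := L0; lra.
have [|w fw sw] := @lattes_nsize z; first by rewrite -(absval_gt0 vP) vd.
by exists w; rewrite // sw vn vd divff ?gt_eqF// expr1n mulr1.
Qed.

(** Here [lam] dominates both terms, and the factor is [64 |8|^3 = 1/8]. *)
Lemma lattes_lt_half z : nsize z < 1 / 2 ->
  exists2 w, f (Some z) = Some w & nsize w = 8^-1 * nsize z.
Proof.
rewrite -(ltr_pM2r L0) => s1.
have vd : v (z ^+ 3 + lam) = v lam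
  by apply: absval_addr => //; rewrite vcube; have := L0; lra.
have vn : v (z ^+ 3 - 8 * lam) = v lam / 8.
  by rewrite -v8lam -(absvalN vP (8 * _));
    apply: absval_addr => //; rewrite absvalN// v8lam vcube; have := L0; lra.
have [|w fw sw] := @lattes_nsize z; first by rewrite -(absval_gt0 vP) vd.
exists w => //; rewrite sw vn vd.
by have := lt0r_neq0 L0; move: (v lam) => a a0; field.
Qed.

(** Cancellation can occur only in the denominator, which enlarges the image: its size is at least
    [64 * 4]. *)
Lemma lattes_eq4 z : nsize z = 4 -> z ^+ 3 != - lam ->
  exists2 w, f (Some z) = Some w & 4 < nsize w.
Proof.
move=> s4 nz; have vz : v (z ^+ 3) = v lam by rewrite vcube s4; lra.
have nz' : z ^+ 3 + lam != 0 by rewrite addr_eq0.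
have vd0 : 0 < v (z ^+ 3 + lam) by rewrite absval_gt0.
have vd : v (z ^+ 3 + lam) <= v lam.
  by have := absval_ultra vP (z ^+ 3) lam; rewrite vz maxxx.
have vn : v (z ^+ 3 - 8 * lam) = v lam.
  by rewrite -vz; apply: absval_addl => //;
    rewrite absvalN// v8lam vz; have := L0; lra.
have [//|w fw sw] := @lattes_nsize z; exists w => //.
have : 1 <= (v lam / v (z ^+ 3 + lam)) ^+ 3.
  by rewrite exprn_ege1// ler_pdivlMr// mul1r.
by rewrite sw vn s4; lra.
Qed.

(** Cancellation can occur only in the numerator, so the image has size at most
    [64 * (1/2) / 8^3 = 1/16]. *)
Lemma lattes_eq_half z : nsize z = 1 / 2 -> z ^+ 3 != 8 * lam ->
  exists2 w, f (Some z) = Some w & 0 < nsize w < 1 / 2.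
Proof.
move=> s1 nz; have vz : v (z ^+ 3) = v lam / 8 by rewrite vcube s1; lra.
have vd : v (z ^+ 3 + lam) = v lam
  by apply: absval_addr => //; rewrite vz; have := L0; lra.
have vn0 : 0 < v (z ^+ 3 - 8 * lam) by rewrite absval_gt0// subr_eq0.
have vn : v (z ^+ 3 - 8 * lam) <= v lam / 8.
  by have := absval_ultra vP (z ^+ 3) (- (8 * lam));
    rewrite absvalN// v8lam vz maxxx.
have [|w fw sw] := @lattes_nsize z; first by rewrite -(absval_gt0 vP) vd.
exists w => //; rewrite sw vd s1; set q := (X in X ^+ 3).
have q0 : 0 < q by rewrite divr_gt0.
have q8 : q <= 8^-1 by rewrite ler_pdivrMr// [8^-1 * _]mulrC.
have q30 : 0 < q ^+ 3 by rewrite exprn_gt0.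
have q38 : q ^+ 3 <= 8^-1 ^+ 3 by rewrite lerXn2r ?nnegrE ?(ltW q0)// invr_ge0.
by apply/andP; split; lra.
Qed.

(** * Preperiodic orbits on and off the circle of size 1 *)

Lemma geometric_not_preperiodic (c : R) (P : R -> Prop) z :
  0 < c -> c != 1 -> (forall s, P s -> 0 < s /\ P (c * s)) ->
  (forall y, P (nsize y) ->
     exists2 w, f (Some y) = Some w & nsize w = c * nsize y) ->
  P (nsize z) -> ~ preperiodic f (Some z).
Proof.
move=> c0 c1 Pc fc Pz.
(* [P] is a forward-invariant range of sizes; the orbit has sizes [c^n * nsize z], pairwise distinct
   as [c] is positive and not 1. *)
have iterc n : exists w, [/\ iter n f (Some z) = Some w,
    P (nsize w) & nsize w = c ^+ n * nsize z].
  elim: n => [|n [w [ew Pw sw]]]; first by exists z; rewrite expr0 mul1r.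
  have [y fy sy] := fc w Pw; exists y; split; first by rewrite iterS ew.
    by rewrite sy; case: (Pc _ Pw).
  by rewrite sy sw exprS mulrA.
move=> [m [n [mn]]].
have [w [-> _ sw]] := iterc m; have [y [-> _ sy]] := iterc n.
case=> wy; move: sw; rewrite wy sy => /mulIf.
have z0 : nsize z != 0 by rewrite gt_eqF//; case: (Pc _ Pz).
by move=> /(_ z0)/(ieexprIn c0 c1) nm; rewrite nm ltnn in mn.
Qed.

Lemma gt4_not_preperiodic z : 4 < nsize z -> ~ preperiodic f (Some z).
Proof.
apply: (@geometric_not_preperiodic 64 (> 4)) => //.
- by rewrite gt_eqF ?ltr1n.
- by move=> s s4; split; lra.
- exact: lattes_gt4.
Qed.

Lemma lt_half_not_preperiodic z : 0 < nsize z < 1 / 2 ->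
  ~ preperiodic f (Some z).
Proof.
apply: (@geometric_not_preperiodic 8^-1 (fun s => 0 < s < 1 / 2)).
- by rewrite invr_gt0.
- by rewrite lt_eqF// invf_lt1// ltr1n.
- by move=> s /andP[s0 s1]; split; last (apply/andP; split); lra.
- by move=> y /andP[_]; exact: lattes_lt_half.
Qed.

Lemma lattes_iter_nsize1 z n : nsize z = 1 ->
  exists2 w, iter n f (Some z) = Some w & nsize w = 1.
Proof.
move=> s1; elim: n => [|n [w ew sw]]; first by exists z.
have [|y fy sy] := @lattes_annulus w; first by rewrite sw; apply/andP; split;
  lra.
by exists y; rewrite ?iterS ?ew// sy sw expr1n.
Qed.

Lemma preperiodic_gt1 z : 1 < nsize z -> preperiodic f (Some z) ->
  exists m w, [/\ iter m f (Some z) = Some w, w ^+ 3 = - lam &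
    nsize z ^+ (4 ^ m) = 4].
Proof.
move=> s1 pz; have [n] := expX4_unbounded 4 s1.
(* Once the size reaches 4, any point other than a pole escapes, now or after one step. *)
have sink y : 4 <= nsize y -> preperiodic f (Some y) ->
    exists m w, [/\ iter m f (Some y) = Some w, w ^+ 3 = - lam &
      nsize y ^+ (4 ^ m) = 4].
  rewrite le_eqVlt => /predU1P[/esym s4|s4] py;
    last by case: (gt4_not_preperiodic s4).
  have [y3|y3] := eqVneq (y ^+ 3) (- lam); first by exists 0%N, y.
  have [w fy sw] := lattes_eq4 s4 y3.
  by case: (gt4_not_preperiodic sw); rewrite -fy; exact: (preperiodic_iter 1).
(* Below 4 each step raises the size to its fourth power, so [n] bounds the number of steps left. *)
elim: n z s1 pz => [|n IH] z s1 pz; first by rewrite expr1 => /sink; apply.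
rewrite expnS exprM => sn; have [s4|s4] := leP 4 (nsize z); first exact: sink.
have [|w fz sw] := @lattes_annulus z; first by apply/andP; split; lra.
have [|||m [y [ey y3 sy]]] := IH w.
- by rewrite sw exprn_egt1.
- by rewrite -fz; exact: (preperiodic_iter 1).
- by rewrite sw.
- by exists m.+1, y; rewrite iterSr fz expnS exprM -sw.
Qed.

(** Mirror image of the case above 1: sizes fall to 1/2 or below, and only a cube equal to [8 * lam]
    avoids shrinking forever. *)
Lemma preperiodic_lt1 z : 0 < nsize z < 1 -> preperiodic f (Some z) ->
  exists m w, [/\ iter m f (Some z) = Some w, w ^+ 3 = 8 * lam &
    nsize z ^+ (4 ^ m) = 2^-1].
Proof.
move=> s01 pz; have [|n] := @expX4_vanishing _ _ 2^-1 s01; first by lra.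
have sink y : 0 < nsize y <= 2^-1 -> preperiodic f (Some y) ->
    exists m w, [/\ iter m f (Some y) = Some w, w ^+ 3 = 8 * lam &
      nsize y ^+ (4 ^ m) = 2^-1].
  move=> /andP[s0]; rewrite le_eqVlt => /predU1P[s1|s1] py; last first.
    by case: (@lt_half_not_preperiodic y) => //; rewrite s0 mul1r.
  have [y3|y3] := eqVneq (y ^+ 3) (8 * lam); first by exists 0%N, y.
  have [|w fy sw] := lattes_eq_half _ y3; first by rewrite s1 mul1r.
  by case: (lt_half_not_preperiodic sw); rewrite -fy;
    exact: (preperiodic_iter 1).
elim: n z s01 pz => [|n IH] z /andP[s0 s1] pz.
  by rewrite expr1 => ?; apply: sink => //; rewrite s0.
rewrite expnS exprM => sn; have [sh|sh] := leP (nsize z) 2^-1.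
  by apply: sink => //; rewrite s0.
have [|w fz sw] := @lattes_annulus z; first by apply/andP; split; lra.
have [|||m [y [ey y3 sy]]] := IH w.
- by rewrite sw exprn_gt0// exprn_ilt1 ?ltW.
- by rewrite -fz; exact: (preperiodic_iter 1).
- by rewrite sw.
- by exists m.+1, y; rewrite iterSr fz expnS exprM -sw.
Qed.

(** * From orbits and sizes to the values of [|lam|] *)

Let orb z := forward_orbit f (Some z).

(** Both points are fixed, so at time [m + n] the orbit would be at both. *)
Lemma orbit_None_0 z : orb z None -> orb z (Some 0) -> False.
Proof.
move=> [m _ em] [n _ en]; have : iter m f (iter n f (Some z)) = Some 0.
  by rewrite en iter_lattes_0.
by rewrite -iterD addnC iterD em iter_lattes_None.
Qed.

Lemma nsize_eq z (x : R) : 0 < x -> nsize z = x <-> v lam = 4 / x * v z ^+ 3.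
Proof.
move=> x0; have xn0 := lt0r_neq0 x0; have Ln0 := lt0r_neq0 L0.
rewrite /nsize; split=> [e|Le].
  have v0 : v z != 0.
    by apply: contra_eq_neq e => ->; rewrite expr0n mulr0 mul0r eq_sym.
  by rewrite -e; field; rewrite v0 Ln0.
have v0 : v z != 0.
  by apply: contra_eq_neq Le => ->; rewrite expr0n mulr0.
by rewrite Le; field; rewrite v0 xn0.
Qed.

End Lattes.

(** This and [pow2D] bring the listed values to the form [4 / x] of [nsize_eq], where [x] is the
    size of [alpha]. *)
Lemma pow1B (R : realType) (q : R) : 4 `^ (1 - q) = 4 / 4 `^ q :> R.
Proof. by rewrite powRB ?powRr1 ?pnatr_eq0 ?implybT. Qed.

Lemma pow2D (R : realType) (q : R) : 2 `^ (2 + q) = 4 / 2^-1 `^ q :> R.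
Proof.
rewrite powRD ?pnatr_eq0 ?implybT// -(powR_inv1 (a := 2))//
  -powRrM mulN1r powRN invrK.
by rewrite powR_mulrn//; congr (_ * _); rewrite -natrX.
Qed.

Theorem theorem2p6 (R : realType) (C2 : fieldType) (absv : C2 -> R)
    (hC2 : is_C2 absv) (alpha lam : C2) (halpha : alpha != 0)
    (hlam : preperiodic_params alpha lam) :
  ((lam = - alpha ^+ 3 \/ lam = alpha ^+ 3 / 8) \/
   ([set 4 * absv alpha ^+ 3]
    `|` [set 4 `^ (1 - (1 / 4) ^+ m) * absv alpha ^+ 3 | m in [set m : nat | (1 <= m)%N]]
    `|` [set 2 `^ (2 + (1 / 4) ^+ m) * absv alpha ^+ 3 | m in [set m : nat | (1 <= m)%N]])
   (absv lam))
  /\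
  let P1 := absv lam = 4 * absv alpha ^+ 3 in
  let P2 := (exists m : nat, (1 <= m)%N /\
               absv lam = 4 `^ (1 - (1 / 4) ^+ m) * absv alpha ^+ 3)
            \/ lam = - alpha ^+ 3 in
  let P3 := (exists m : nat, (1 <= m)%N /\
               absv lam = 2 `^ (2 + (1 / 4) ^+ m) * absv alpha ^+ 3)
            \/ lam = alpha ^+ 3 / 8 in
  let orb := forward_orbit (lattes lam) (Some alpha) in
  [/\ exactly_one3 P1 P2 P3,
      P1 <-> ~ orb (Some 0) /\ ~ orb None,
      P2 <-> orb None
    & P3 <-> orb (Some 0)].
Proof.
have [vP v2] := is_C2_absval hC2; case: hlam => lam0 pre.
set s := nsize absv lam alpha.
have s0 : 0 < s by rewrite nsize_gt0.
have q0 m : 0 < (1 / 4) ^+ m :> R by rewrite exprn_gt0.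
have sE (x : R) : 0 < x -> s = x <-> absv lam = 4 / x * absv alpha ^+ 3
  by exact: nsize_eq.
have sE4 m : s = 4 `^ ((1 / 4) ^+ m) <->
    absv lam = 4 `^ (1 - (1 / 4) ^+ m) * absv alpha ^+ 3.
  by rewrite pow1B; apply: sE; rewrite powR_gt0.
have sE2 m : s = 2^-1 `^ ((1 / 4) ^+ m) <->
    absv lam = 2 `^ (2 + (1 / 4) ^+ m) * absv alpha ^+ 3.
  by rewrite pow2D; apply: sE; rewrite powR_gt0.
have and_imply (A B : Prop) : B -> (B -> A) -> A /\ B
  by move=> b ab; split=> //; exact: ab.
(* The list of possible [lam] is read off from the trichotomy, which remains to be proved. *)
apply: and_imply => [P1 P2 P3 orb|]; last first.
  move=> [[[h _ _]|[_ [[m [m1 h]]|h] _]|[_ _ [[m [m1 h]]|h]]] _ _ _].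
  - by right; left; left.
  - by right; left; right; exists m.
  - by left; left.
  - by right; right; exists m.
  - by left; right.
(* The three alternatives correspond to [s = 1], [s > 1] and [s < 1]. *)
have P1s : P1 <-> s = 1 by rewrite sE// divr1.
have powR_1 m : 1 = 1 `^ ((1 / 4) ^+ m) :> R by rewrite powR1.
have P2s : P2 -> 1 < s.
  case=> [[m [_ /sE4 ->]]|e].
    by rewrite [ltLHS](powR_1 m) gt0_ltr_powR ?nnegrE// ltr1n.
  have -> : s = 4; last by rewrite ltr1n.
  by apply/sE => //; rewrite divff ?pnatr_eq0// mul1r e absvalN// absvalX.
have P3s : P3 -> s < 1.
  case=> [[m [_ /sE2 ->]]|e].
    by rewrite [ltRHS](powR_1 m) gt0_ltr_powR ?nnegrE//
      ?invr_ge0// invf_lt1 ?ltr1n.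
  have -> : s = 2^-1; last by rewrite invf_lt1 ?ltr1n.
  apply/sE => //; rewrite ?invr_gt0// e absvalM// absvalV// absvalX//.
  rewrite -[8%N]/((2 ^ 3)%N) natrX absvalX// v2; lra.
have H1 : s = 1 -> ~ orb (Some 0) /\ ~ orb None.
  move=> s1; split=> -[n _];
    have [w -> sw] := lattes_iter_nsize1 vP v2 lam0 n s1 => //.
  by move=> [w0]; have := nsize_gt0 vP lam0 w; rewrite sw w0 eqxx ltr01.
have H2 : 1 < s -> P2 /\ orb None.
  move=> s1; have [m [w [ew w3 sm]]] := preperiodic_gt1 vP v2 lam0 s1 pre.
  (* Infinity is reached one step after the pole. *)
  split; last by exists m.+1; rewrite //= ew; exact: lattes_pole.
  (* If [m = 0], [alpha] itself is the pole and [lam] is determined; otherwise only [|lam|] is. *)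
  case: m ew sm => [[aw] _|m _ sm]; first by right; rewrite aw w3 opprK.
  by left; exists m.+1; split=> //; apply/sE4/expX4_powR.
have H3 : s < 1 -> P3 /\ orb (Some 0).
  move=> s1; have s01 : 0 < s < 1 by rewrite s0.
  have [m [w [ew w3 sm]]] := preperiodic_lt1 vP v2 lam0 s01 pre.
  split; last by exists m.+1; rewrite //= ew; exact: (lattes_zero vP v2).
  (* For [m = 0], [alpha^3 = 8 * lam], and dividing needs [8 != 0], which follows from
     [|8| = 1/8]. *)
  case: m ew sm => [[aw] _|m _ sm].
    right; rewrite aw w3 mulrC mulKf// -(absval_gt0 vP).
    by rewrite -[8%N]/((2 ^ 3)%N) natrX absvalX// v2; lra.
  by left; exists m.+1; split=> //; apply/sE2/expX4_powR.
have H0 : orb None -> orb (Some 0) -> False by exact: (orbit_None_0 vP v2 lam0).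
have [s_lt1|s_gt1|s1] := ltgtP s 1.
- have [p3 o0] := H3 s_lt1.
  have nP1 : ~ P1 by move=> /P1s s1; rewrite s1 ltxx in s_lt1.
  have nP2 : ~ P2 by move=> /P2s /(lt_trans s_lt1); rewrite ltxx.
  have noN : ~ orb None by move=> /H0; exact.
  by split; [apply: Or33|split=> // -[]|split|split].
- have [p2 oN] := H2 s_gt1.
  have nP1 : ~ P1 by move=> /P1s s1; rewrite s1 ltxx in s_gt1.
  have nP3 : ~ P3 by move=> /P3s /(lt_trans s_gt1); rewrite ltxx.
  have no0 : ~ orb (Some 0) by exact: H0.
  by split; [apply: Or32|split=> // -[]|split|split].
- have p1 : P1 by apply/P1s.
  have nP2 : ~ P2 by move=> /P2s; rewrite s1 ltxx.
  have nP3 : ~ P3 by move=> /P3s; rewrite s1 ltxx.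
  have [n0 nN] := H1 s1.
  by split; [apply: Or31|split|split|split].
Qed.
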